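(* Let $(G,\chi_V,\chi_E)$ be a vertex- and arc-colored graph (with arbitrary colorings) such that $G$ excludes $K_h$ as a topological subgraph, and let $X\subseteq V(G)$. Let $t\ge 3h^3$ and $D:=\mathrm{cl}_t^{G}(X)$. Then for the vertex set $Z$ of any connected component of $G-D$, we have $|N_G(Z)|<h$.
   Context: Graphs are finite, simple, undirected. $N_G(Z)=(\bigcup_{v\in Z}N_G(v))\setminus Z$. $H$ is a topological subgraph of $G$ if some subdivision of $H$ (each edge replaced by a path of length $\ge1$) is a subgraph of $G$. A vertex-coloring $\chi_V$ assigns colors to vertices; an arc-coloring $\chi_E$ assigns colors to ordered pairs $(u,v)$ with $uv\in E(G)$. For a vertex-coloring $\chi$, $[v]_\chi=\{w\mid \chi(w)=\chi(v)\}$. Color Refinement: given $(G,\chi,\chi_E)$ set $\chi^{(0)}=\chi$ and $\chi^{(i+1)}(v)=(\chi^{(i)}(v),\{\!\{(\chi^{(i)}(w),\chi_E(v,w),\chi_E(w,v))\mid w\in N_G(v)\}\!\})$; the stable coloring $\mathrm{WL}_1(G,\chi,\chi_E)$ is $\chi^{(i)}$ for the least $i$ such that $\chi^{(i+1)}$ induces the same partition as $\chi^{(i)}$. Closure: define $\chi_0(v)=(v,1)$ if $v\in X$ and $(\chi_V(v),0)$ otherwise; $\chi_{2i+1}=\mathrm{WL}_1(G,\chi_{2i},\chi_E)$; $\chi_{2i+2}(v)=(v,1)$ if $|[v]_{\chi_{2i+1}}|\le t$ and $(\chi_{2i+1}(v),0)$ otherwise. Let $i^*$ be minimal such that $\chi_{i^*}$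 and $\chi_{i^*+1}$ induce the same partition. Then $\mathrm{cl}_t^{G}(X)=\mathrm{cl}_t^{(G,\chi_V,\chi_E)}(X):=\{v\in V(G)\mid |[v]_{\chi_{i^*}}|=1\}$.
   Formalization: The index i* is taken as the least i with χ_i, χ_{i+1}, χ_{i+2} all inducing the same partition; with only χ_i and χ_{i+1} the process may stop at i*=0 and the claim fails (K_{2,5}, X the side of size 5, h=5). For i ≥ 1 both conditions agree. *)

(* Defs.v *)
From HB Require Import structures.
From mathcomp Require Import all_boot.
From mathcomp Require Import finmap multiset.

Set Implicit Arguments.
Unset Strict Implicit.
Unset Printing Implicit Defensive.

(* A graph is a finType T of vertices with a symmetric irreflexive e : rel T. *)

Section Graphs.
Variables (T : finType) (e : rel T).

Definition nbhd (v : T) : {set T} := [set w | e v w].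

Definition nbhd_set (Z : {set T}) : {set T} :=
  (\bigcup_(v in Z) nbhd v) :\: Z.

Definition del_rel (D : {set T}) : rel T :=
  [rel x y | [&& x \notin D, y \notin D & e x y]].

Definition component_of_deletion (D Z : {set T}) : Prop :=
  exists2 v, v \notin D & Z = [set w | connect (del_rel D) v w].

End Graphs.

Definition complete_graph (h : nat) : rel 'I_h := [rel i j | i != j].
Arguments complete_graph : clear implicits.

(* (V, E) is a subdivision of H: f gives the branch vertices, and P a b lists
   the internal vertices, from f a to f b, of the path replacing the edge ab. *)
Definition is_subdivision (S : finType) (H : rel S)
    (T : finType) (V : {set T}) (E : rel T) : Prop :=
  exists (f : S -> T) (P : S -> S -> seq T),
  [/\ injective f,
      forall a b, H a b ->
        [/\ P b a = rev (P a b), uniq (P a b) & forall c, f c \notin P a b],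
      forall a b c d x, H a b -> H c d -> x \in P a b -> x \in P c d ->
        (c, d) = (a, b) \/ (c, d) = (b, a),
      forall x, x \in V <->
        (exists a, x = f a) \/ (exists a b, H a b /\ x \in P a b)
    & forall x y, E x y <->
        exists a b, H a b /\ infix [:: x; y] (f a :: rcons (P a b) (f b))].

Definition topological_subgraph (S : finType) (H : rel S)
    (T : finType) (e : rel T) : Prop :=
  exists (V : {set T}) (E : rel T), is_subdivision H V E /\ subrel E e.

Section Colorings.
Variable T : finType.

(* The set of colors changes along color refinement, so it is bundled. *)
Record coloring := Coloring { color : choiceType; col :> T -> color }.

Definition color_class (c : coloring) (v : T) : {set T} :=
  [set w | c w == c v].

Definition same_partition (c d : coloring) : bool :=
  [forall u, forall v, (c u == c v) == (d u == d v)].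

(* inl v stands for the color (v, 1), inr x for the color (x, 0). *)
Definition individualize (A : pred T) (c : coloring) : coloring :=
  @Coloring (T + color c)%type (fun v => if A v then inl v else inr (c v)).

Definition refines (d c : coloring) : Prop :=
  forall u v, d u = d v -> c u = c v.

Lemma refining_seq_stabilizes (s : nat -> coloring) :
  (forall i, refines (s i.+1) (s i)) ->
  exists i, same_partition (s i) (s i.+1) && same_partition (s i.+1) (s i.+2).
Proof.
move=> s_ref; pose K i := [set p : T * T | s i p.1 == s i p.2].
have subK i : K i.+1 \subset K i.
  by apply/subsetP => p; rewrite !inE => /eqP/s_ref ->.
have eqK i j : K i = K j -> same_partition (s i) (s j).
  move=> eqij; apply/forallP => u; apply/forallP => v.
  by have /setP/(_ (u, v)) := eqij; rewrite !inE => ->.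
suff [i Ki] : exists i, #|K i| <= #|K i.+2|.
  have sub2 := subset_trans (subK i.+1) (subK i).
  have E2 : K i.+2 = K i by apply/eqP; rewrite eqEcard sub2.
  have E1 : K i.+1 = K i by apply/eqP; rewrite eqEsubset subK -{1}E2 subK.
  by exists i; rewrite !eqK // ?E1 ?E2.
have [n] := ubnP #|K 0|; move: 0; elim: n => // n IHn i lt_i.
have [le_i|lt_i2] := leqP #|K i| #|K i.+2|; first by exists i.
by apply: (IHn i.+2); apply: leq_trans lt_i2 _.
Qed.

Lemma individualize_refines A c : refines (individualize A c) c.
Proof. by move=> u v /=; case: ifP; case: ifP => // _ _ []// ->. Qed.

End Colorings.

Section ColorRefinement.
(* Only the values chiE v w with e v w, i.e. the colors of arcs, are used. *)
Variables (T : finType) (e : rel T) (CE : choiceType) (chiE : T -> T -> CE).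

Definition cr_step (c : coloring T) : coloring T :=
  @Coloring T (color c * {mset (color c * CE * CE)%type}%mset)%type
    (fun v => (c v, seq_mset [seq (c w, chiE v w, chiE w v)
                               | w <- enum (nbhd e v)])).

Lemma cr_step_refines c : refines (cr_step c) c.
Proof. by move=> u v [->]. Qed.

Lemma cr_stabilizes (c : coloring T) :
  exists i, same_partition (iter i cr_step c) (iter i.+1 cr_step c).
Proof.
have [|i /andP[si _]] := @refining_seq_stabilizes T (fun i => iter i cr_step c).
  by move=> i; apply: cr_step_refines.
by exists i.
Qed.

Definition WL1 (c : coloring T) : coloring T :=
  iter (ex_minn (cr_stabilizes c)) cr_step c.

Lemma WL1_refines c : refines (WL1 c) c.
Proof.
rewrite /WL1; elim: (ex_minn _) => //= i IHi u v Euv.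
exact/IHi/cr_step_refines.
Qed.

Variables (CV : choiceType) (chiV : T -> CV) (t : nat) (X : {set T}).

Fixpoint cl_seq (i : nat) : coloring T :=
  if i is j.+1 then
    if odd j then individualize (fun v => #|color_class (cl_seq j) v| <= t)
                                (cl_seq j)
    else WL1 (cl_seq j)
  else individualize (mem X) (Coloring chiV).

Lemma cl_seq_stabilizes :
  exists i, same_partition (cl_seq i) (cl_seq i.+1)
            && same_partition (cl_seq i.+1) (cl_seq i.+2).
Proof.
apply: refining_seq_stabilizes => i /=.
by case: ifP => _; [apply: individualize_refines | apply: WL1_refines].
Qed.

(* The least index at which the sequence has stabilized: neither of the two
   alternating operations refines the partition any more. From index 1 on, one
   step without refinement already implies this. At index 0 it does not: if
   the initial coloring is stable under color refinement, then cl_seq 0 and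
   cl_seq 1 induce the same partition although individualizing the classes of
   size at most t has not been tried yet. *)
Definition cl_index : nat := ex_minn cl_seq_stabilizes.

Definition cl : {set T} :=
  [set v | #|color_class (cl_seq cl_index) v| == 1].

End ColorRefinement.

(* Main.v *)
Require Import Defs.
From mathcomp Require Import all_boot.
From mathcomp Require Import zify.
From mathcomp Require multiset.

Set Implicit Arguments.
Unset Strict Implicit.
Unset Printing Implicit Defensive.

(** In the stable coloring reached by the closure, every vertex of [D] forms a
    class of its own, while the classes meeting [Z] have more than [3 h^3]
    elements; two adjacent classes span a biregular bipartite graph. A vertex of
    [N(Z)] with a neighbor in [Z] is adjacent to the whole class of that neighbor.
    So if [N(Z)] contains [h] vertices, a [K_h] subdivision with these branch
    vertices exists as soon as there are [h^2] disjoint connected subgraphs, each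
    meeting all [h] attachment classes.

    The subgraphs are lifts of a tree of classes that contains the attachment
    classes. They are added one at a time: when [q] of them exist, the vertices of
    a class through which no further one can be routed have density at most
    [q / m] times the number of segments of the tree that lie between attachment
    or branching classes, where [m] bounds the class sizes from below. Inside a
    segment this is a Menger argument, phrased with matroids: the sets that can be
    matched into the independent sets of the next class form a matroid again, and
    Rado's theorem together with biregularity transports the density bound.
    There are at most [2h - 1] segments, so [h^2] subgraphs can be found. *)

(** * Matroid rank and Rado's theorem *)

Section Matroid.
Variable T : finType.
Implicit Types (M F : {set {set T}}) (I J K U V X Y : {set T})
  (E : {set T * T}).

Definition down_closed F := forall I J, J \subset I -> I \in F -> J \in F.

Definition matroid M :=
  [/\ set0 \in M, down_closed M &
    forall I J, I \in M -> J \in M -> #|I| < #|J| ->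
      exists2 x, x \in J :\: I & x |: I \in M].

Definition rank M U := \max_(I in M | I \subset U) #|I|.

Lemma leq_rank M U I : I \in M -> I \subset U -> #|I| <= rank M U.
Proof.
by move=> IM IU; rewrite /rank (bigD1 I) /= ?IM // leq_maxl.
Qed.

Lemma rankP M U : matroid M ->
  exists I, [/\ I \in M, I \subset U & #|I| = rank M U].
Proof.
case=> M0 _ _; rewrite /rank.
have [|I /andP[IM IU] ->] :=
    @eq_bigmax_cond _ [pred I in M | I \subset U] (fun I => #|I|).
  by apply/card_gt0P; exists set0; rewrite inE M0 sub0set.
by exists I.
Qed.

Lemma leq_rank_sub M U V : matroid M -> U \subset V -> rank M U <= rank M V.
Proof.
move=> mM UV; have [I [IM IU <-]] := rankP U mM.
by apply: leq_rank => //; apply: subset_trans UV.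
Qed.

Lemma extend_basis M U I : matroid M -> I \in M -> I \subset U ->
  exists J, [/\ J \in M, I \subset J, J \subset U & #|J| = rank M U].
Proof.
move=> mM; have [K [KM KU rK]] := rankP U mM.
have [n] := ubnP (rank M U - #|I|); elim: n I => // n IHn I le_n IM IU.
have [ltI|] := ltnP #|I| (rank M U); last first.
  by move=> ge; exists I; split=> //; apply/eqP; rewrite eqn_leq ge leq_rank.
have [_ _ /(_ I K IM KM)] := mM; rewrite rK => /(_ ltI)[x].
rewrite inE => /andP[xI xK] xIM.
have xIU : x |: I \subset U by rewrite subUset sub1set (subsetP KU) // IU.
have [|J [JM sub JU rJ]] := IHn _ _ xIM xIU.
  by rewrite cardsU1 xI; move: le_n ltI; clear; lia.
by exists J; split=> //; apply: subset_trans sub; apply: subsetU1.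
Qed.

(** A basis [I] of the intersection extends to a basis [J] of the union; [J :&: X] and [J :&: Y] are
    independent and share all of [I]. *)
Lemma rank_submodular M X Y : matroid M ->
  rank M (X :|: Y) + rank M (X :&: Y) <= rank M X + rank M Y.
Proof.
move=> mM; have [I [IM IXY <-]] := rankP (X :&: Y) mM.
have IU : I \subset X :|: Y.
  by apply: subset_trans IXY _; rewrite subIset // subsetUl.
have [J [JM IJ JU <-]] := extend_basis mM IM IU.
have [_ dM _] := mM.
have le_in Z : #|J :&: Z| <= rank M Z.
  by apply: leq_rank; [apply: dM JM; apply: subsetIl | apply: subsetIr].
apply: leq_trans (leq_add (le_in X) (le_in Y)).
rewrite -(cardsUI (J :&: X)) -setIUr (setIidPl JU) leq_add2l subset_leq_card //.
by rewrite -setIIr subsetI IJ IXY.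
Qed.

Definition nbrs (E : {set T * T}) V := [set c | [exists b in V, (b, c) \in E]].

Lemma nbrsP E V c :
  reflect (exists2 b, b \in V & (b, c) \in E) (c \in nbrs E V).
Proof. by rewrite inE; apply: exists_inP. Qed.

(* Welsh's proof of Rado's theorem: if a vertex has two edges, submodularity
   shows that one of them can be deleted without violating the condition. *)
Theorem rado M E U q : matroid M ->
  (forall V, V \subset U -> q <= rank M (nbrs E V) + #|U :\: V|) ->
  exists I (f : T -> T), [/\ I \subset U, q <= #|I|, {in I &, injective f},
    {in I, forall b, (b, f b) \in E} & f @: I \in M].
Proof.
move=> mM; have [n] := ubnP #|E|; elim: n E => // n IHn E leE hq.
have [|/existsPn noE] := boolP [exists b in U, exists c1, exists c2,
    [&& c1 != c2, (b, c1) \in E & (b, c2) \in E]].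
  case/existsP=> b /andP[bU /existsP[c1 /existsP[c2 /and3P[c12 bc1 bc2]]]].
  pose ok c := [forall (V : {set T} | V \subset U),
    q <= rank M (nbrs (E :\ (b, c)) V) + #|U :\: V|].
  have useok c : (b, c) \in E -> ok c -> exists I (f : T -> T),
      [/\ I \subset U, q <= #|I|, {in I &, injective f},
        {in I, forall b, (b, f b) \in E} & f @: I \in M].
    move=> bc /forall_inP okc.
    have [||I [f [IU qI fI fE fM]]] := IHn (E :\ (b, c)).
    - by move: leE; rewrite (cardsD1 (b, c) E) bc.
    - by move=> V /okc.
    exists I, f; split=> // x /fE; by rewrite inE => /andP[].
  have [okc|/forall_inPn[V1 V1U]] := boolP (ok c1); first exact: useok okc.
  rewrite -ltnNge => lt1; have {}V1U : V1 \subset U := V1U.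
  have [okc|/forall_inPn[V2 V2U]] := boolP (ok c2); first exact: useok okc.
  rewrite -ltnNge => lt2; have {}V2U : V2 \subset U := V2U; exfalso.
  (* Without [b], a set keeps its neighbors when an edge at [b] is deleted; so every violating set
     contains [b]. *)
  have inV c V : V \subset U -> rank M (nbrs (E :\ (b, c)) V) + #|U :\: V| < q ->
      b \in V.
    move=> VU; apply: contraTT => bV; rewrite -leqNgt.
    rewrite (leq_trans (hq V VU)) // leq_add2r leq_rank_sub //.
    apply/subsetP => d /nbrsP[b' b'V b'd]; apply/nbrsP; exists b' => //.
    rewrite !inE b'd andbT; apply: contra bV => /eqP[<- _] //.
  have bV1 := inV _ _ V1U lt1; have bV2 := inV _ _ V2U lt2.
  set X1 := nbrs _ V1 in lt1; set X2 := nbrs _ V2 in lt2.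
  have subU : nbrs E (V1 :|: V2) \subset X1 :|: X2.
    apply/subsetP => d /nbrsP[b' b'V b'd]; rewrite inE.
    have [/eqP[eb ed]|ne1] := boolP ((b', d) == (b, c1)).
      apply/orP; right; apply/nbrsP; exists b => //.
      by rewrite !inE ed bc1 andbT; apply: contra c12 => /eqP[->].
    have [/eqP[eb ed]|ne2] := boolP ((b', d) == (b, c2)).
      apply/orP; left; apply/nbrsP; exists b => //.
      by rewrite !inE ed bc2 andbT; apply: contra c12 => /eqP[->].
    move: b'V; rewrite inE => /orP[b'V|b'V]; apply/orP; [left|right];
    by apply/nbrsP; exists b' => //; rewrite !inE ?ne1 ?ne2 b'd.
  have subI : nbrs E ((V1 :&: V2) :\ b) \subset X1 :&: X2.
    apply/subsetP => d /nbrsP[b']; rewrite !in_setD1 in_setI.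
    case/and3P=> nb b'1 b'2 b'd.
    have ne c : (b', d) != (b, c) by apply: contra nb => /eqP[->].
    by rewrite inE; apply/andP; split; apply/nbrsP; exists b';
       rewrite // in_setD1 ne b'd.
  (* Submodularity for [X1] and [X2] contradicts the hypothesis on [V1 :|: V2] and
     [(V1 :&: V2) :\ b]: removing [b] costs 1, while the two strict violations gain 2. *)
  have V12U : V1 :|: V2 \subset U by rewrite subUset V1U V2U.
  have VIU : (V1 :&: V2) :\ b \subset U.
    by apply: subset_trans (subsetDl _ _) _; rewrite subIset ?V1U.
  have h1 := hq _ V12U; have h2 := hq _ VIU.
  have r1 := leq_rank_sub mM subU; have r2 := leq_rank_sub mM subI.
  have sm := rank_submodular X1 X2 mM.
  have cD V : V \subset U -> #|U :\: V| + #|V| = #|U|.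
    by move=> VU; rewrite cardsD (setIidPr VU) subnK // subset_leq_card.
  have := cardsUI V1 V2; have := cardsD1 b (V1 :&: V2).
  rewrite inE bV1 bV2 /=.
  have := cD _ V1U; have := cD _ V2U; have := cD _ V12U; have := cD _ VIU.
  move: lt1 lt2 h1 h2 r1 r2 sm; clear; lia.
have func b c1 c2 : b \in U -> (b, c1) \in E -> (b, c2) \in E -> c1 = c2.
  move=> bU bc1 bc2; apply/eqP; apply: contraT => ne.
  have := noE b; rewrite bU /= => /existsPn/(_ c1)/existsPn/(_ c2).
  by rewrite ne bc1 bc2.
have [J [JM JN rJ]] := rankP (nbrs E U) mM.
have qJ : q <= #|J| 
  by rewrite rJ; have := hq U (subxx _); rewrite setDv cards0 addn0.
pose g c := odflt c [pick b in U | (b, c) \in E].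
have gP c : c \in J -> g c \in U /\ (g c, c) \in E.
  move=> /(subsetP JN)/nbrsP[b bU bc]; rewrite /g.
  by case: pickP => [x /andP[]|/(_ b)] //=; rewrite bU bc.
pose f b := odflt b [pick c | (b, c) \in E].
have fg c : c \in J -> f (g c) = c.
  move=> cJ; have [gU gE] := gP c cJ; rewrite /f.
  case: pickP => [x /= xE|/(_ c)]; last by rewrite gE.
  exact: func xE gE.
have gI : {in J &, injective g} by move=> c d cJ dJ /(congr1 f); rewrite !fg.
exists (g @: J), f; split.
- by apply/subsetP => _ /imsetP[c /gP[] gU _ ->].
- by rewrite card_in_imset.
- by move=> _ _ /imsetP[c cJ ->] /imsetP[d dJ ->]; rewrite !fg // => ->.
- by move=> _ /imsetP[c cJ ->]; rewrite fg //; have [] := gP c cJ.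
- suff -> : f @: (g @: J) = J by [].
  apply/setP => c; apply/imsetP/idP => [[_ /imsetP[d dJ ->] ->]|cJ].
    by rewrite fg.
  by exists (g c); rewrite ?fg // imset_f.
Qed.

(** * Matroids induced along edges *)

Variable e : rel T.

(** [F] is arbitrary because families of routable sets need not be matroids; the finite function
    makes membership decidable. *)
Definition induced F (B : {set T}) : {set {set T}} :=
  [set I : {set T} | (I \subset B) && [exists f : {ffun T -> T},
    [&& dinjectiveb f [in I], [forall b in I, e b (f b)] & f @: I \in F]]].

Lemma inducedP F (B : {set T}) I : reflect
  (I \subset B /\ exists f : T -> T,
    [/\ {in I &, injective f}, {in I, forall b, e b (f b)} & f @: I \in F])
  (I \in induced F B).
Proof.
rewrite inE; apply: (iffP andP) => [[IB /existsP[f /and3P[fI fe fF]]]|].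
  by split=> //; exists f; split=> //; [apply/dinjectiveP | apply/forall_inP].
case=> IB [f [fI fe fF]]; split=> //; apply/existsP; exists (finfun f).
apply/and3P; split.
- by apply/dinjectiveP => x y xI yI; rewrite !ffunE; apply: fI.
- by apply/forall_inP => b bI; rewrite ffunE fe.
- suff -> : finfun f @: I = f @: I by [].
  by apply: eq_imset => x; rewrite ffunE.
Qed.

Lemma induced_sub F (B : {set T}) I : I \in induced F B -> I \subset B.
Proof. by case/inducedP. Qed.

Lemma inducedS F F' B : F \subset F' -> induced F B \subset induced F' B.
Proof.
move=> FF'; apply/subsetP => I /inducedP[IB [f [fI fe fF]]].
by apply/inducedP; split=> //; exists f; split=> //; apply: (subsetP FF').
Qed.

Lemma induced0 F B : set0 \in F -> set0 \in induced F B.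
Proof.
move=> F0; apply/inducedP; split; first exact: sub0set.
by exists id; rewrite imset0; split=> // x; rewrite inE.
Qed.

Lemma induced_down F B : down_closed F -> down_closed (induced F B).
Proof.
move=> dF I J JI /inducedP[IB [f [fI fe fF]]].
apply/inducedP; split; first exact: subset_trans IB.
exists f; split; last by apply: dF fF; apply: imsetS.
- by move=> x y /(subsetP JI) xI /(subsetP JI) yI; apply: fI.
- by move=> x /(subsetP JI); apply: fe.
Qed.

(* Augment in M and push the new edge of g into f; each time this does not
   enlarge the domain, f agrees with g at one more vertex. *)
Lemma induced_matroid M B : matroid M -> matroid (induced M B).
Proof.
move=> mM; have [M0 dM aM] := mM; split.
- exact: induced0.
- exact: induced_down.
move=> I K /inducedP[IB [f]] fP /inducedP[KB [g [gI ge gM]]] ltIK.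
have [n] := ubnP #|[set b in I | f b != g b]|.
elim: n f fP => // n IHn f [fI fe fM] len.
have [|c] := aM _ _ fM gM; first by rewrite !card_in_imset.
rewrite inE => /andP[cf /imsetP[b bK def_c]] cM.
pose f' x := if x == b then c else f x.
have f'I J : J \subset I -> {in b |: J &, injective f'}.
  move=> /subsetP JI x y; rewrite /f' !inE.
  have cN z : z \in I -> c <> f z.
    by move=> zI Ec; case/negP: cf; rewrite Ec imset_f.
  case: eqP => [->|_]; case: eqP => [->|_] //= xJ yJ.
  - by move/(cN y (JI y yJ)).
  - by move=> E; case: (cN x (JI x xJ)); rewrite E.
  - exact: fI (JI x xJ) (JI y yJ).
have f'e : {in b |: I, forall x, e x (f' x)}.
  move=> x; rewrite /f' !inE; case: eqP => [-> _|_ /= xI]; last exact: fe.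
  by rewrite def_c ge.
have f'M : f' @: (b |: I) \in M.
  apply: dM cM; apply/subsetP => _ /imsetP[x xI ->]; rewrite /f'.
  move: xI; rewrite !inE; case: eqP => [_|_ /= xI]; first by rewrite eqxx.
  by rewrite imset_f ?orbT.
have [bI|bI] := boolP (b \in I); last first.
  exists b; first by rewrite inE bI.
  apply/inducedP; split; first by rewrite subUset sub1set (subsetP KB) // IB.
  by exists f'; split=> //; apply: f'I.
have bII : b |: I = I by apply/setUidPr; rewrite sub1set.
apply: (IHn f'); first by split; rewrite -bII //; apply: f'I.
move: len; rewrite ltnS; apply: leq_trans; apply: proper_card.
apply/properP; split.
  apply/subsetP => x; rewrite !inE /f'; case: (x =P b) => [->|//].
  by rewrite def_c eqxx andbF.
exists b; rewrite !inE bI /f' ?eqxx -?def_c ?eqxx //=.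
by apply: contra cf => /eqP <-; rewrite imset_f.
Qed.

(** One half of the min-max formula for the induced rank: with [q] one above that rank, the
    conclusion of [rado] is impossible, so some [V] violates its hypothesis. *)
Lemma rank_induced M (B C U : {set T}) : matroid M ->
    U \subset B -> (forall I, I \in M -> I \subset C) ->
  exists2 V : {set T}, V \subset U &
    rank M ([set c in C | [exists b in V, e b c]]) + #|U :\: V|
      <= rank (induced M B) U.
Proof.
move=> mM UB MC; pose E := [set p : T * T | (p.2 \in C) && e p.1 p.2].
have nE V : nbrs E V = [set c in C | [exists b in V, e b c]].
  apply/setP => c; rewrite !inE; apply/existsP/andP.
    case=> b; rewrite inE => /and3P[bV cC bc]; split=> //.
    by apply/existsP; exists b; rewrite bV.
  by case=> cC /existsP[b /andP[bV bc]]; exists b; rewrite inE bV cC.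
have [/existsP[V /andP[VU hV]]|/existsPn noV] := boolP [exists V : {set T},
    (V \subset U) && (rank M (nbrs E V) + #|U :\: V| <= rank (induced M B) U)].
  by exists V; rewrite // -nE.
have [|I [f [IU qI fI fE fM]]] := @rado M E U (rank (induced M B) U).+1 mM.
  by move=> V VU; have := noV V; rewrite VU /= -ltnNge.
suff: #|I| <= rank (induced M B) U by rewrite leqNgt qI.
apply: leq_rank => //; apply/inducedP; split; first exact: subset_trans UB.
by exists f; split=> // b /fE; rewrite inE => /andP[].
Qed.

End Matroid.

(** * Connected vertex sets *)

Section Connected.
Variables (T : finType) (e : rel T).

Definition restr (H : {set T}) : rel T :=
  [rel x y | [&& x \in H, y \in H & e x y]].

Definition conn_set (H : {set T}) : Prop :=
  {in H &, forall x y, connect (restr H) x y}.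

Lemma connect_restrS (H K : {set T}) x y :
  H \subset K -> connect (restr H) x y -> connect (restr K) x y.
Proof.
move=> /subsetP HK; apply: connect_sub => u v /and3P[uH vH uv].
by apply: connect1; rewrite /restr /= !HK.
Qed.

Lemma conn_set1 x : conn_set [set x].
Proof. by move=> y z /set1P-> /set1P->. Qed.

Lemma connect_restr_closed (S K : {set T}) x y :
    (forall u v, u \in K -> restr S u v -> v \in K) -> x \in K ->
  connect (restr S) x y -> connect (restr K) x y.
Proof.
move=> Kc xK /connectP[p pP ->]; elim: p x xK pP => //= z p IHp x xK /andP[xz pP].
have zK := Kc x z xK xz; apply: connect_trans (IHp z zK pP).
by apply: connect1; rewrite /restr /= xK zK; case/and3P: xz.
Qed.

(** A simple path does not revisit its start, so everything after the first step avoids [x]. *)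
Lemma connect_restr_first (S : {set T}) x y : y != x -> connect (restr S) x y ->
  exists z, [/\ z \in S :\ x, e x z & connect (restr (S :\ x)) z y].
Proof.
move=> yx /connectP[p0 p0P]; case/shortenP: p0P => -[|z p] /= xzp.
  by move=> _ _ Ey; rewrite Ey eqxx in yx.
case/andP: xzp => /and3P[xS zS xz] zp /andP[xN _] _ ->.
have zx : z != x by apply: contra xN => /eqP->; rewrite mem_head.
exists z; split; rewrite ?in_setD1 ?zx //; apply/connectP; exists p => //.
apply: sub_in_path (_ : all (predC1 x) (z :: p)) zp.
  move=> u v; rewrite !inE => ux vx /and3P[uS vS uv].
  by rewrite /restr /= !in_setD1 ux vx uS vS.
by apply/allP => u uzp; rewrite inE; apply: contra xN => /eqP<-.
Qed.

Hypothesis e_sym : symmetric e.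

Lemma connect_restr_sym H : connect_sym (restr H).
Proof. by apply: sym_connect_sym => x y; rewrite /restr /= e_sym andbCA. Qed.

Lemma conn_setU (H K : {set T}) x y : conn_set H -> conn_set K ->
  x \in H -> y \in K -> (x == y) || e x y -> conn_set (H :|: K).
Proof.
move=> cH cK xH yK xy.
have cxy : connect (restr (H :|: K)) x y.
  case/orP: xy => [/eqP<-|xy]; first exact: connect0.
  by apply: connect1; rewrite /restr /= !inE xH yK orbT.
have cx z : z \in H :|: K -> connect (restr (H :|: K)) x z.
  rewrite inE => /orP[zH|zK].
    by apply: connect_restrS (cH x z xH zH); apply: subsetUl.
  apply: connect_trans cxy _.
  by apply: connect_restrS (cK y z yK zK); apply: subsetUr.
move=> u v /cx xu /cx xv; apply: connect_trans xv.
by rewrite connect_restr_sym.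
Qed.

End Connected.

(** * Greedily extendable families and their transport between classes *)

Section Families.
Variables (T : finType) (e : rel T) (m : nat).
Implicit Types (B C I J U V : {set T}) (F M : {set {set T}}).

(** The blocked elements, in [I] or not addable to it, have density at most [k * #|I| / m] in
    [B]. *)
Definition augmentable k B F := forall I, I \in F ->
  m * #|[set u in B | (u \in I) || (u |: I \notin F)]| <= k * #|I| * #|B|.

(* A form of augmentability that passes through an edge between two classes
   without loss. *)
Definition locally_matroidal k B F := forall I, I \in F ->
  exists M, [/\ matroid M, M \subset F, I \in M &
    forall U, U \subset B ->
      m * #|U| <= (k * #|I| + rank M U) * #|B| \/ #|U :&: I| < rank M U].

(** Densities without division: passing from [V] to its neighbors in [C] does not lower the
    density. *)
Definition spread B C := forall V, V \subset B ->
  #|V| * #|C| <= #|[set c in C | [exists b in V, e b c]]| * #|B|.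

(** If the blocked set [U] had rank above [#|I|], exchange would add one of its elements to [I]. As
    [U] contains [I], the second alternative fails; the first costs one extra unit for the rank
    term. *)
Lemma locally_matroidal_augmentable k B F : (forall I, I \in F -> I \subset B) ->
  locally_matroidal k B F -> augmentable k.+1 B F.
Proof.
move=> FB lF I IF; have [M [mM MF IM hM]] := lF I IF.
set U := [set _ in _ | _].
have UB : U \subset B by apply/subsetP => u; rewrite inE => /andP[].
have rU : rank M U <= #|I|.
  rewrite leqNgt; apply/negP; have [K [KM KU <-]] := rankP U mM => ltIK.
  have [_ _ /(_ I K IM KM ltIK)[x]] := mM.
  rewrite inE => /andP[xI /(subsetP KU)]; rewrite !inE (negPf xI) /=.
  by case/andP=> _ /negP nF /(subsetP MF).
have IU : U :&: I = I.
  apply/setIidPr/subsetP => u uI; rewrite inE uI /= andbT.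
  exact: (subsetP (FB I IF)).
have [le|] := hM U UB; last by rewrite IU ltnNge rU.
by apply: leq_trans le _; rewrite leq_mul2r mulSn addnC leq_add2r rU orbT.
Qed.

(* The matroid has as independent sets the subsets of I plus at most one element
   by which I can be extended. *)
Lemma augmentable_locally_matroidal k B F : down_closed F ->
  augmentable k B F -> locally_matroidal k B F.
Proof.
move=> dF aF I IF.
pose R := [set u in B | (u \notin I) && (u |: I \in F)].
pose M := [set K : {set T} | (K \subset I :|: R) && (#|K :&: R| <= 1)].
have IR : I :&: R = set0.
  by apply/setP => x; rewrite !inE; case: (x \in I); rewrite //= andbF.
have addI x J : J \subset I -> x \in R -> x |: J \in M.
  move=> JI xR; rewrite inE; apply/andP; split.
    by rewrite subUset sub1set inE xR orbT subsetU ?JI.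
  rewrite -(cards1 x) subset_leq_card //; apply/subsetP => y.
  rewrite !inE => /andP[/orP[//|/(subsetP JI) yI]].
  by rewrite yI andbF.
have subI J : J \subset I -> J \in M.
  move=> JI; rewrite inE (subset_trans JI (subsetUl _ _)).
  by rewrite (_ : J :&: R = set0) ?cards0 //; apply/eqP; rewrite -subset0 -IR setSI.
have MP K : K \in M -> K \subset I \/ exists2 x, x \in R & K \subset x |: I.
  rewrite inE => /andP[/subsetP KIR cK].
  have [KR0|/set0Pn[x xKR]] := eqVneq (K :&: R) set0.
    left; apply/subsetP => y yK; have := KIR y yK; rewrite inE.
    have: y \notin K :&: R by rewrite KR0 inE.
    by rewrite inE yK /= => /negPf->; rewrite orbF.
  right; exists x; first by case/setIP: xKR.
  apply/subsetP => y yK; have := KIR y yK; rewrite !in_setU in_set1.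
  case/orP=> [->|yR]; first by rewrite orbT.
  by rewrite (card_le1_eqP cK y x) ?eqxx // inE yK.
have mM : matroid M.
  split; first exact: subI (sub0set I).
    move=> J K KJ; rewrite !inE => /andP[JIR cJ]; rewrite (subset_trans KJ) //=.
    by apply: leq_trans cJ; rewrite subset_leq_card // setSI.
  move=> J K JM KM ltJK.
  have /andP[KIR cK] : (K \subset I :|: R) && (#|K :&: R| <= 1) by
    rewrite inE in KM.
  have /andP[JIR cJ] : (J \subset I :|: R) && (#|J :&: R| <= 1) by
    rewrite inE in JM.
  (* If [J] misses [R], it lies in [I] and can take any element of [K]. Otherwise [K] has no more
     elements in [R] than [J], hence more outside [R]. *)
  have [JR0|JR] := eqVneq (J :&: R) set0.
    have /subsetPn[x xK xJ] : ~~ (K \subset J).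
      by apply: contraL ltJK => /subset_leq_card; rewrite -leqNgt.
    have JI : J \subset I.
      case: (MP J JM) => // -[x' x'R Jx']; apply/subsetP => y yJ.
      have := subsetP Jx' y yJ; rewrite in_setU1 => /orP[/eqP yx|//].
      have: y \in J :&: R by rewrite in_setI yJ yx.
      by rewrite JR0 in_set0.
    exists x; first by rewrite inE xJ.
    have := subsetP KIR x xK; rewrite inE => /orP[xI|xR]; last exact: addI.
    by apply: subI; rewrite subUset sub1set xI.
  have /subsetPn[x xKR xJ] : ~~ (K :\: R \subset J :\: R).
    apply: contraL ltJK => /subset_leq_card le; rewrite -leqNgt.
    rewrite -(cardsID R K) -(cardsID R J) leq_add //.
    by apply: leq_trans cK _; rewrite card_gt0.
  move: xKR xJ; rewrite !in_setD => /andP[xR xK]; rewrite xR /= => xJ.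
  exists x; first by rewrite inE xJ.
  rewrite inE; apply/andP; split.
    by rewrite subUset sub1set JIR (subsetP KIR).
  rewrite setIUl (_ : [set x] :&: R = set0) ?set0U //.
  apply/setP => y; rewrite in_setI in_set1 in_set0.
  by case: eqP => [->|//]; apply/negbTE.
exists M; split=> //.
- apply/subsetP => K /MP[KI|[x xR KxI]]; first exact: dF IF.
  by apply: dF KxI _; move: xR; rewrite !inE => /and3P[].
- exact: subI.
(* If [U] misses [R], all of [U] is blocked and its density is bounded; an element of [U :&: R]
   extends [U :&: I] inside [M]. *)
move=> U UB; have [UR|/set0Pn[x]] := eqVneq (U :&: R) set0.
  left; rewrite mulnDl; apply: leq_trans (leq_addr _ _).
  apply: leq_trans (aF I IF); rewrite leq_mul2l subset_leq_card ?orbT //.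
  apply/subsetP => u uU; rewrite inE (subsetP UB) //=.
  have: u \notin U :&: R by rewrite UR inE.
  rewrite !inE uU (subsetP UB) //= negb_and negbK.
  by case: (u \in I).
rewrite inE => /andP[xU xR]; right.
have xI : x \notin I by move: xR; rewrite inE => /and3P[].
have := leq_rank (addI x (U :&: I) (subsetIr _ _) xR) (_ : _ \subset U).
rewrite cardsU1 inE (negPf xI) andbF; apply.
by rewrite subUset sub1set xU subsetIl.
Qed.

(** [rank_induced] provides a part [V] of [U]. A density bound for the neighbors of [V] passes to
    [V] by [spread], and [m <= #|B|] pays for [U :\: V]. If instead their rank exceeds their overlap
    with [f @: I], adding [#|U :\: V|] gives the second alternative for [U]. *)
Lemma locally_matroidal_induced k B C F :
    (forall I, I \in F -> I \subset C) -> spread B C -> 0 < #|C| -> m <= #|B| ->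
  locally_matroidal k C F -> locally_matroidal k B (induced e F B).
Proof.
move=> FC sBC C0 mB lF I /inducedP[IB [f [fI fe fF]]].
have [M [mM MF JM hM]] := lF _ fF; rewrite card_in_imset // in hM.
have MC K : K \in M -> K \subset C by move/(subsetP MF)/FC.
exists (induced e M B); split.
- exact: induced_matroid.
- exact: inducedS.
- by apply/inducedP; split=> //; exists f.
move=> U UB; have [V VU] := rank_induced e mM UB MC.
set N := [set c in C | _] => rV.
have NC : N \subset C by apply/subsetP => c; rewrite inE => /andP[].
have UD : #|U| = #|V| + #|U :\: V|.
  by rewrite -(cardsID V U) (setIidPr VU).
have [le|lt] := hM N NC; [left|right].
  have hV : m * #|V| <= (k * #|I| + rank M N) * #|B|.
    rewrite -(leq_pmul2r C0) -mulnA.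
    apply: leq_trans (leq_mul (leqnn m) (sBC V (subset_trans VU UB))) _.
    by rewrite mulnA [leqRHS]mulnAC leq_mul2r le orbT.
  have hD : m * #|U :\: V| <= #|U :\: V| * #|B| by rewrite mulnC leq_mul2l mB orbT.
  rewrite UD mulnDr; apply: leq_trans (leq_add hV hD) _.
  by rewrite -mulnDl leq_mul2r -addnA leq_add2l rV orbT.
apply: leq_trans rV.
have -> : #|U :&: I| = #|V :&: I| + #|(U :\: V) :&: I|.
  rewrite -(cardsID V (U :&: I)) setIAC (setIidPr VU).
  congr (_ + _); apply: eq_card => x; rewrite !inE.
  by case: (x \in V); rewrite ?andbF.
rewrite -addSn leq_add ?subset_leq_card ?subsetIl //.
apply: leq_trans lt; rewrite ltnS.
have <- : #|f @: (V :&: I)| = #|V :&: I|.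
  by apply: card_in_imset => x y /setIP[_ xI] /setIP[_ yI]; apply: fI.
apply/subset_leq_card/subsetP => _ /imsetP[x /setIP[xV xI] ->].
rewrite inE imset_f // andbT inE (subsetP (FC _ fF)) ?imset_f //=.
by apply/existsP; exists x; rewrite xV fe.
Qed.

(** An element blocked for the intersection is blocked for one of the two families. *)
Lemma augmentableI k1 k2 B F1 F2 :
  augmentable k1 B F1 -> augmentable k2 B F2 -> augmentable (k1 + k2) B (F1 :&: F2).
Proof.
move=> a1 a2 I /setIP[I1 I2]; rewrite !mulnDl.
apply: leq_trans (leq_add (a1 I I1) (a2 I I2)); rewrite -mulnDr leq_mul2l.
apply/orP; right; apply: leq_trans (leq_card_setU _ _).
apply/subset_leq_card/subsetP => u; rewrite !inE negb_and.
by case: (u \in B); case: (u \in I); case: (_ \in F1).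
Qed.

Lemma locally_matroidal_powerset B :
  m <= #|B| -> locally_matroidal 0 B (powerset B).
Proof.
move=> mB I; rewrite powersetE => IB; exists (powerset B); split=> //.
- split; first by rewrite powersetE sub0set.
    by move=> J K KJ; rewrite !powersetE; apply: subset_trans.
  move=> J K; rewrite !powersetE => JB KB ltJK.
  have /subsetPn[x xK xJ] : ~~ (K \subset J).
    by apply: contraL ltJK => /subset_leq_card; rewrite -leqNgt.
  exists x; first by rewrite in_setD xJ.
  by rewrite powersetE subUset sub1set (subsetP KB).
- by rewrite powersetE.
move=> U UB; left; rewrite mul0n add0n mulnC leq_mul //.
by apply: leq_rank; rewrite ?powersetE.
Qed.

(** While [k * q < m], the blocked elements have density below one, so some element of [B] can be
    added. *)
Lemma augmentable_grow k B F N : set0 \in F -> 0 < #|B| ->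
    (forall q, q < N -> k * q < m) -> augmentable k B F ->
  exists2 I, I \in F & #|I| = N.
Proof.
move=> F0 B0 hN aF; elim: N hN => [|N IHN] hN.
  by exists set0; rewrite ?cards0.
have [q qN|I IF cI] := IHN; first exact: hN (ltnW _).
have := aF I IF; set U := [set _ in _ | _]; rewrite cI => le.
have /subsetPn[x xB xU] : ~~ (B \subset U).
  apply: contraL le => /subset_leq_card BU; rewrite -ltnNge.
  apply: leq_trans (leq_mul (leqnn m) BU); by rewrite ltn_pmul2r // hN.
move: xU; rewrite inE xB /= negb_or negbK => /andP[xI xIF].
by exists (x |: I); rewrite // cardsU1 xI cI.
Qed.

End Families.

(** * Disjoint connected subgraphs routed through classes *)

Section Linkages.
Variables (T : finType) (e : rel T) (e_sym : symmetric e).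
Implicit Types (B C I : {set T}) (W A F : {set {set T}}).

(** [W] holds the classes used, [A] those to be reached, and [B] is the root. Since [H x] meets [B]
    in [x] only, subgraphs from different branches can be glued at a common root. *)
Definition realizable W A B F := forall I, I \in F -> exists H : T -> {set T},
  [/\ {in I, forall x, [/\ x \in H x, conn_set e (H x) & H x \subset cover W]},
      {in I, forall x C, C \in A -> exists2 y, y \in H x & y \in C},
      {in I, forall x, H x :&: B \subset [set x]} &
      {in I &, forall x y, x != y -> [disjoint H x & H y]}].

Lemma realizable_powerset W B : B \in W -> realizable W [set B] B (powerset B).
Proof.
move=> BW I; rewrite powersetE => /subsetP IB; exists set1; split=> x.
- move=> xI; rewrite set11; split=> //; first exact: conn_set1.
  by rewrite sub1set; apply/bigcupP; exists B; rewrite // IB.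
- by move=> xI C /set1P->; exists x; rewrite ?set11 // IB.
- by move=> _; apply: subsetIl.
- by move=> y xI yI xy; rewrite disjoints1 in_set1.
Qed.

Lemma realizable_induced W A B C F : [disjoint B & cover W] ->
  realizable W A C F -> realizable (B |: W) A B (induced e F B).
Proof.
move=> dBW rF I /inducedP[/subsetP IB [f [fI fe fF]]].
have [H [H1 H2 H3 H4]] := rF _ fF; exists (fun x => x |: H (f x)).
have notB x y : x \in I -> y \in B -> y \in H (f x) -> False.
  move=> xI yB yH; have [_ _ /subsetP/(_ y yH)] := H1 _ (imset_f f xI).
  by rewrite (disjointFr dBW).
split=> x.
- move=> xI; have [fxH cH HW] := H1 _ (imset_f f xI); split.
  + by rewrite setU11.
  + apply: (conn_setU e_sym (conn_set1 e (x := x)) cH (set11 x) fxH).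
    by rewrite fe ?orbT.
  rewrite /cover bigcup_setU big_set1 setUSS // sub1set; exact: IB.
- move=> xI D DA; have [y yH yD] := H2 _ (imset_f f xI) D DA.
  by exists y; rewrite // in_setU1 yH orbT.
- move=> xI; apply/subsetP => y; rewrite in_setI in_setU1 in_set1.
  by case/andP=> /orP[//|yH] yB; case: (notB x y).
move=> y xI yI xy; have dH : [disjoint H (f x) & H (f y)].
  by apply: H4; rewrite ?imset_f //; apply: contra xy => /eqP/fI->.
rewrite -setI_eq0; apply/eqP/setP => z; rewrite in_setI !in_setU1 in_set0.
apply/negP; case/andP=> /orP[/eqP->|zx] /orP[/eqP|zy].
- by move/eqP; rewrite (negPf xy).
- exact: notB yI (IB x xI) zy.
- by move=> Ez; apply: notB xI (IB y yI) _; rewrite -Ez.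
- by rewrite (disjointFr dH) in zy.
Qed.

(** Subgraphs with the same root are glued there. [H x] and [K y] can meet only in [B], where each
    contains just its own root. *)
Lemma realizableI W1 W2 A1 A2 B F1 F2 : cover W1 :&: cover W2 \subset B ->
    realizable W1 A1 B F1 -> realizable W2 A2 B F2 ->
  realizable (W1 :|: W2) (A1 :|: A2) B (F1 :&: F2).
Proof.
move=> sB r1 r2 I /setIP[/r1[H [H1 H2 H3 H4]] /r2[K [K1 K2 K3 K4]]].
exists (fun x => H x :|: K x).
have HK x y z : x \in I -> y \in I -> x != y -> z \in H x -> z \in K y -> False.
  move=> xI yI xy zH zK.
  have [_ _ /subsetP/(_ z zH) zW1] := H1 x xI.
  have [_ _ /subsetP/(_ z zK) zW2] := K1 y yI.
  have zB : z \in B by apply: (subsetP sB); rewrite inE zW1.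
  have := subsetP (H3 x xI) z; rewrite in_setI zH zB => /(_ isT)/set1P Ex.
  have := subsetP (K3 y yI) z; rewrite in_setI zK zB => /(_ isT)/set1P Ey.
  by rewrite -Ex -Ey eqxx in xy.
split=> x.
- move=> xI; have [xH cH HW] := H1 x xI; have [xK cK KW] := K1 x xI; split.
  + by rewrite inE xH.
  + by apply: (conn_setU e_sym cH cK xH xK); rewrite eqxx.
  + by rewrite /cover bigcup_setU setUSS.
- move=> xI C; rewrite inE => /orP[CA|CA].
    by have [y yH yC] := H2 x xI C CA; exists y; rewrite // inE yH.
  by have [y yH yC] := K2 x xI C CA; exists y; rewrite // inE yH orbT.
- by move=> xI; rewrite setIUl subUset H3 ?K3.
move=> y xI yI xy; rewrite -setI_eq0; apply/eqP/setP => z.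
rewrite in_setI !in_setU in_set0; apply/negP.
case/andP=> /orP[zx|zx] /orP[zy|zy].
- by rewrite (disjointFr (H4 x y xI yI xy)) in zy.
- exact: HK zx zy.
- by apply: HK zy zx; rewrite // eq_sym.
- by rewrite (disjointFr (K4 x y xI yI xy)) in zy.
Qed.

Definition linkage m k W A B F :=
  [/\ set0 \in F, down_closed F, forall I, I \in F -> I \subset B,
      realizable W A B F & locally_matroidal m k B F].

Lemma linkageS m k W W' A B F :
  W \subset W' -> linkage m k W A B F -> linkage m k W' A B F.
Proof.
move=> sW [F0 dF FB rF lF]; split=> // I /rF[H [H1 H2 H3 H4]].
exists H; split=> // x /H1[xH cH HW]; split=> //; apply: subset_trans HW _.
by apply/bigcupsP => C CW; apply: (bigcup_sup C); rewrite ?(subsetP sW).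
Qed.

Lemma linkage_powerset m W B : B \in W -> m <= #|B| ->
  linkage m 0 W [set B] B (powerset B).
Proof.
move=> BW mB; split.
- by rewrite powersetE sub0set.
- by move=> I J JI; rewrite !powersetE; apply: subset_trans.
- by move=> I; rewrite powersetE.
- exact: realizable_powerset.
- exact: locally_matroidal_powerset.
Qed.

Lemma linkage_induced m k W A B C F : [disjoint B & cover W] ->
    spread e B C -> 0 < #|C| -> m <= #|B| ->
  linkage m k W A C F -> linkage m k (B |: W) A B (induced e F B).
Proof.
move=> dBW sBC C0 mB [F0 dF FC rF lF]; split.
- exact: induced0.
- exact: induced_down.
- by move=> I; apply: induced_sub.
- exact: realizable_induced rF.
- exact: locally_matroidal_induced lF.
Qed.

(** Each family pays one unit to become augmentable, the losses add up, and the return to the local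
    matroid form is free. *)
Lemma linkageI m k1 k2 W1 W2 A1 A2 B F1 F2 : cover W1 :&: cover W2 \subset B ->
    linkage m k1 W1 A1 B F1 -> linkage m k2 W2 A2 B F2 ->
  linkage m (k1.+1 + k2.+1) (W1 :|: W2) (A1 :|: A2) B (F1 :&: F2).
Proof.
move=> sB [F01 dF1 FB1 r1 l1] [F02 dF2 FB2 r2 l2].
have dF : down_closed (F1 :&: F2).
  by move=> I J JI; rewrite !inE => /andP[/(dF1 _ _ JI)-> /(dF2 _ _ JI)->].
split=> //.
- by rewrite inE F01.
- by move=> I /setIP[/FB1].
- exact: realizableI.
- apply: augmentable_locally_matroidal => //.
  by apply: augmentableI; apply: locally_matroidal_augmentable.
Qed.

Variables (m : nat) (Q : {set {set T}}) (adj : rel {set T}).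
Hypotheses (trivQ : trivIset Q) (adj_sym : symmetric adj).
Hypothesis adjQ : {in Q &, forall B C, adj B C -> spread e B C}.
Hypotheses (m_gt0 : 0 < m) (sizeQ : {in Q, forall B, m <= #|B|}).

Lemma cover_setI W1 W2 : W1 \subset Q -> W2 \subset Q ->
  cover W1 :&: cover W2 \subset cover (W1 :&: W2).
Proof.
move=> /subsetP s1 /subsetP s2; apply/subsetP => z.
case/setIP=> /bigcupP[D D1 zD] /bigcupP[E E2 zE].
have ED : D = E.
  apply/eqP; apply: contraT => ne.
  have := trivIsetP trivQ D E (s1 D D1) (s2 E E2) ne.
  by move/disjointFr=> /(_ z zD); rewrite zE.
by apply/bigcupP; exists D; rewrite // inE D1 ED.
Qed.

(** Induction on [#|W|]. Some [a] in [A] other than [r] lies in a component [K] of [W :\ r]. A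
    linkage inside [K] is carried over an edge to [r] at no loss and, if classes of [A] remain,
    combined with one in [W :\: K]. Only combining costs, two units each time, which gives
    [#|A|.*2 - 2]. *)
Theorem linkage_exists W A r :
    W \subset Q -> r \in W -> A \subset W -> A != set0 ->
    {in A, forall B, connect (restr adj W) r B} ->
  exists F, linkage m (#|A|.*2 - 2) W A r F.
Proof.
have [n] := ubnP #|W|; elim: n W A r => // n IHn W A r.
rewrite ltnS => leW WQ rW AW A0 cA.
have [Ar|/subsetPn[a aA]] := boolP (A \subset [set r]).
  have -> : A = [set r].
    by apply/eqP; move: Ar; rewrite subset1 (negPf A0) orbF.
  exists (powerset r); rewrite cards1.
  by apply: linkage_powerset; rewrite ?sizeQ ?(subsetP WQ).
rewrite in_set1 => ar.
have aW := subsetP AW a aA.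
pose Wr := W :\ r; pose K := [set x in Wr | connect (restr adj Wr) a x].
have KW : K \subset W by apply/subsetP => x; rewrite !inE => /andP[/andP[]].
have KQ := subset_trans KW WQ; have rQ := subsetP WQ r rW.
have rK : r \notin K by rewrite !inE eqxx.
have aK : a \in K by rewrite !inE ar aW connect0.
have symWr := connect_restr_sym adj_sym Wr.
have [r' [r'W rr' r'a]] := connect_restr_first ar (cA a aA).
have r'K : r' \in K by rewrite inE r'W symWr.
have r'Q := subsetP KQ r' r'K.
have [||||||F1 L1] := IHn K (A :&: K) r'; rewrite ?subsetIr //.
- apply: leq_trans leW; apply/proper_card/properP; split=> //.
  by exists r.
- by apply/set0Pn; exists a; rewrite inE aA.
- move=> B /setIP[_ BK]; apply: connect_restr_closed (r'K) _ => [u v|].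
    move=> /setIdP[_ au] uv; have /and3P[_ vW _] := uv.
    by rewrite inE vW; apply: connect_trans au (connect1 uv).
  by apply: connect_trans r'a _; move: BK; rewrite inE => /andP[].
have drK : [disjoint r & cover K].
  rewrite -setI_eq0 -subset0 -(cover1 r).
  apply: subset_trans (cover_setI _ KQ) _; first by rewrite sub1set.
  rewrite (_ : [set r] :&: K = set0) ?/cover ?big_set0 //.
  by apply/eqP; rewrite setI_eq0 disjoints1.
have {}L1 : linkage m (#|A :&: K|.*2 - 2) (r |: K) (A :&: K) r (induced e F1 r).
  apply: linkage_induced L1 => //; first exact: adjQ.
    by apply: leq_trans m_gt0 (sizeQ r'Q).
  exact: sizeQ.
have [A20|A20] := eqVneq (A :\: K) set0.
  have AK : A \subset K by rewrite -setD_eq0 A20.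
  exists (induced e F1 r); move: L1; rewrite (setIidPl AK); apply: linkageS.
  by rewrite subUset sub1set rW.
have [||||||F2 L2] := IHn (W :\: K) (A :\: K) r; rewrite ?setSD //.
- apply: leq_trans leW; apply/proper_card/properP.
  by split; [apply: subsetDl | exists a; rewrite // inE aK].
- exact: subset_trans (subsetDl _ _) WQ.
- by rewrite inE rK.
(* A simple path from [r] to [B] avoids [K]: after its first step it stays in one component of [Wr],
   and not in that of [a]. *)
- move=> B /setDP[BA BK]; have [->|Br] := eqVneq B r; first exact: connect0.
  have [y [yW ry yB]] := connect_restr_first Br (cA B BA).
  have yK : y \notin K.
    apply: contra BK => /setIdP[_ ay]; rewrite inE in_setD1 Br (subsetP AW) //=.
    exact: connect_trans ay yB.
  apply: connect_trans (_ : connect _ r y) _.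
    apply: connect1; move: yW; rewrite /restr /= !in_setD (negPf rK) yK rW ry.
    by case/andP=> _ ->.
  apply: (@connect_restrS _ _ (Wr :\: K)); first by rewrite setSD ?subsetDl.
  apply: connect_restr_closed yB; last by rewrite in_setD yK.
  move=> u v /setDP[uW uK] uv; have /and3P[_ vW _] := uv.
  rewrite in_setD vW andbT; apply: contra uK => /setIdP[_ av]; rewrite inE uW.
  by apply: connect_trans av _; rewrite symWr connect1.
have a1 : 0 < #|A :&: K| by apply/card_gt0P; exists a; rewrite inE aA.
have a2 : 0 < #|A :\: K| by rewrite card_gt0.
exists (induced e F1 r :&: F2).
have -> : #|A|.*2 - 2 = (#|A :&: K|.*2 - 2).+1 + (#|A :\: K|.*2 - 2).+1.
  by rewrite -(cardsID K A); move: a1 a2; clear; lia.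
have -> : W = (r |: K) :|: (W :\: K).
  apply/setP => x; rewrite in_setU in_setU1 in_setD.
  have [->|_] := eqVneq x r; rewrite ?rW //.
  by case: (boolP (x \in K)) => [/(subsetP KW)|].
rewrite -{3}(setID A K); apply: linkageI => //.
apply: subset_trans (cover_setI _ _) _.
- by rewrite subUset sub1set rQ.
- exact: subset_trans (subsetDl _ _) WQ.
apply/bigcupsP => B; rewrite !inE => /andP[/orP[/eqP->//|BK]].
by rewrite BK.
Qed.

End Linkages.

(** * Equitability of the stable coloring, and the closure *)

Section StableColoring.
Variables (T : finType) (e : rel T).

Lemma double_count (V C : {set T}) :
  \sum_(b in V) #|[set c in C | e b c]| = \sum_(c in C) #|[set b in V | e b c]|.
Proof.
under eq_bigr do rewrite -sum1dep_card.
under [RHS]eq_bigr do rewrite -sum1dep_card.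
rewrite (exchange_big_dep (mem C)) /=; last by move=> b c _ /andP[].
by apply: eq_bigr => c cC; apply: eq_bigl => b; rewrite cC.
Qed.

(** With [N] the neighborhood of [V] in [C], counting edges gives [#|V| * d <= #|N| * d'] and
    [#|B| * d = #|C| * d']; the edge from [b0] to [c0] makes [d'] positive, hence cancellable. *)
Lemma biregular_spread d d' (B C : {set T}) b0 c0 :
    {in B, forall b, #|[set c in C | e b c]| = d} ->
    {in C, forall c, #|[set b in B | e b c]| = d'} ->
  b0 \in B -> c0 \in C -> e b0 c0 -> spread e B C.
Proof.
move=> hd hd' b0B c0C bc V VB; set N := [set c in C | _].
have d'0 : 0 < d'.
  by rewrite -(hd' c0 c0C); apply/card_gt0P; exists b0; rewrite inE b0B.
have EBC : #|B| * d = #|C| * d'.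
  rewrite -!sum_nat_const -(eq_bigr _ hd) -(eq_bigr _ hd'); exact: double_count.
have EV : #|V| * d <= #|N| * d'.
  rewrite -sum_nat_const (eq_bigr (fun b => #|[set c in C | e b c]|)); last first.
    by move=> b bV; rewrite hd ?(subsetP VB).
  rewrite double_count (bigID [in N]) /= [X in _ + X]big1 ?addn0; last first.
    move=> c /andP[cC]; rewrite inE cC /= => /existsPn nc; apply: eq_card0 => b.
    by rewrite inE; apply/negbTE.
  rewrite -sum_nat_const (eq_bigl [in N]); last first.
    by move=> c; rewrite !inE; case: (c \in C).
  apply: leq_sum => c; rewrite inE => /andP[cC _]; rewrite -(hd' c cC).
  by apply/subset_leq_card/subsetP => b; rewrite !inE => /andP[/(subsetP VB)->].
rewrite -(leq_pmul2r d'0) -mulnA -EBC mulnCA [leqRHS]mulnAC mulnC.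
by rewrite leq_mul2r EV orbT.
Qed.

Lemma color_class_same (c d : coloring T) v :
  same_partition c d -> color_class c v = color_class d v.
Proof.
move=> /forallP cd; apply/setP => w; rewrite !inE.
by have /forallP/(_ v)/eqP := cd w.
Qed.

Lemma same_partition_trans (c2 c1 c3 : coloring T) :
  same_partition c1 c2 -> same_partition c2 c3 -> same_partition c1 c3.
Proof.
move=> /forallP s12 /forallP s23; apply/forallP => u; apply/forallP => v.
have /forallP/(_ v)/eqP-> := s12 u; exact: forallP (s23 u) v.
Qed.

Lemma color_class_eq (c : coloring T) u v :
  u \in color_class c v -> color_class c u = color_class c v.
Proof. by rewrite inE => /eqP E; apply/setP => w; rewrite !inE E. Qed.

Variables (CE : choiceType) (chiE : T -> T -> CE).

(** Stability equates the multisets at [u] and [v]; counting the entries whose vertex color is that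
    of [w] forgets the arc colors. *)
Lemma stable_equitable (c : coloring T) u v w :
    same_partition c (cr_step e chiE c) -> c u = c v ->
  #|[set x in color_class c w | e u x]| = #|[set x in color_class c w | e v x]|.
Proof.
move=> /forallP/(_ u)/forallP/(_ v)/eqP; set s1 := cr_step e chiE c.
move=> E Ec; move: E; rewrite Ec eqxx => /esym/eqP[_] /multiset.eq_seq_msetP pe.
have cnt z : count (fun p => p.1.1 == c w)
    [seq (c w, chiE z w, chiE w z) | w <- enum (nbhd e z)]
    = #|[set x in color_class c w | e z x]|.
  rewrite count_map -sum1_count big_enum_cond /= -sum1dep_card.
  by apply: eq_bigl => x; rewrite !inE andbC.
by rewrite -!cnt; apply/permP.
Qed.

Lemma WL1_stable (c : coloring T) :
  same_partition (WL1 e chiE c) (cr_step e chiE (WL1 e chiE c)).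
Proof. by rewrite /WL1; case: ex_minnP. Qed.

Variables (CV : choiceType) (chiV : T -> CV) (t : nat) (X : {set T}).

(** At [cl_index] one step of each kind leaves the partition unchanged. The refinement step gives
    stability, the other makes small classes singletons. The witness is the output of the refinement
    step, so its index depends on parity. *)
Lemma cl_stable : exists c : coloring T,
  [/\ same_partition c (cr_step e chiE c),
      forall v, (v \in cl e chiE chiV t X) = (#|color_class c v| == 1)
    & forall v, #|color_class c v| <= t -> #|color_class c v| = 1].
Proof.
rewrite /cl /cl_index; case: ex_minnP => i /andP[s01 s12] _.
pose s := cl_seq e chiE chiV t X; rewrite -/s in s01 s12 *.
have indiv j v : odd j -> same_partition (s j) (s j.+1) ->
    #|color_class (s j) v| <= t -> #|color_class (s j) v| = 1.
  move=> oj sj le; rewrite (color_class_same v sj); apply/eqP/cards1P.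
  exists v; apply/setP => w; rewrite !inE /s /= oj -/s /= le.
  case: ifP => [//|nle]; apply/esym/negbTE; apply: contraFneq nle => ->; exact: le.
have wl j : ~~ odd j -> same_partition (s j.+1) (cr_step e chiE (s j.+1)).
  by move=> oj; rewrite /s /= (negPf oj); apply: WL1_stable.
have [oi|oi] := boolP (odd i).
  exists (s i.+2); have s02 := same_partition_trans s01 s12.
  split; first by apply: wl; rewrite /= oi.
    by move=> v; rewrite inE (color_class_same v s02).
  by move=> v; rewrite -(color_class_same v s02); apply: indiv.
exists (s i.+1); split; first exact: wl.
  by move=> v; rewrite inE (color_class_same v s01).
by move=> v; apply: indiv.
Qed.

End StableColoring.

(** * Clique subdivisions from disjoint connected sets *)

Section CliqueSubdivision.
Variables (T : finType) (e : rel T) (e_sym : symmetric e).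

Lemma conn_set_path (H : {set T}) u v x y : conn_set e H ->
    x \in H -> e u x -> y \in H -> e v y ->
  exists p, [&& sorted e (u :: rcons p v), uniq p & all [in H] p].
Proof.
move=> cH xH ux yH vy; have /connectP[p0 p0P Ey] := cH x y xH yH.
case/shortenP: p0P Ey => p pP pU _ Ey; exists (x :: p).
have eP : path e x p by apply: sub_path pP => a b /and3P[].
have aP : all [in H] p.
  elim: p x pP {xH ux pU Ey eP} => //= z p IHp x /andP[/and3P[_ -> _]]; exact: IHp.
by rewrite pU /= ux rcons_path eP -Ey e_sym vy xH aP.
Qed.

(** For [i < j] the edge is routed through [H (i, j)], which contains neighbors of both ends;
    disjointness of these sets keeps the paths internally disjoint. *)
Lemma clique_topological_subgraph h (f : 'I_h -> T) (H : 'I_h * 'I_h -> {set T}) :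
    injective f -> (forall p, conn_set e (H p)) ->
    (forall p q, p != q -> [disjoint H p & H q]) ->
    (forall p i, f i \notin H p) ->
    (forall p i, exists2 y, y \in H p & e (f i) y) ->
  topological_subgraph (complete_graph h) e.
Proof.
move=> fI cH dH fH eH.
have ex i j : exists p,
    [&& sorted e (f i :: rcons p (f j)), uniq p & all [in H (i, j)] p].
  have [x xH ix] := eH (i, j) i; have [y yH jy] := eH (i, j) j.
  exact: conn_set_path (cH _) xH ix yH jy.
pose P0 i j := xchoose (ex i j).
pose P (i j : 'I_h) := if i < j then P0 i j else rev (P0 j i).
pose key (i j : 'I_h) := if i < j then (i, j) else (j, i).
have PP i j : [/\ sorted e (f i :: rcons (P i j) (f j)), uniq (P i j)
    & {subset P i j <= H (key i j)}].
  rewrite /P /key; case: ifP => _.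
    by have /and3P[sP uP /allP] := xchooseP (ex i j).
  have /and3P[sP uP /allP aP] := xchooseP (ex j i); split.
  - rewrite -rev_cons -rev_rcons rcons_cons rev_sorted.
    by rewrite (@eq_sorted _ _ e).
  - by rewrite rev_uniq.
  - by move=> x; rewrite mem_rev => /aP.
pose V := [set x | [exists a, x == f a] ||
  [exists a, exists b, (a != b) && (x \in P a b)]].
pose E : rel T := fun x y => [exists a, exists b,
  (a != b) && infix [:: x; y] (f a :: rcons (P a b) (f b))].
exists V, E; split; last first.
  move=> x y /existsP[a /existsP[b /andP[_ xy]]].
  by have [sP _ _] := PP a b; have := infix_sorted xy sP; rewrite /= andbT.
exists f, P; split=> //.
- move=> a b ab; have [_ uP sP] := PP a b; split=> //.
    rewrite /P; case: ltngtP => [||/val_inj E1]; rewrite ?revK //.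
    by rewrite /complete_graph /= E1 eqxx in ab.
  by move=> c; apply/negP => /sP; apply/negP.
- move=> a b c d x _ _ xab xcd; have [_ _ /(_ x xab) x1] := PP a b.
  have [_ _ /(_ x xcd) x2] := PP c d.
  have: key a b = key c d.
    apply/eqP; apply: contraT => /dH/disjointFr/(_ x1); by rewrite x2.
  rewrite /key; case: ifP; case: ifP => _ _ [-> ->]; by [left | right].
- move=> x; rewrite inE; split.
    case/orP=> [/existsP[a /eqP]|/existsP[a /existsP[b /andP[]]]].
      by left; exists a.
    by right; exists a, b.
  case=> [[a ->]|[a [b [ab xP]]]]; apply/orP; [left|right].
    by apply/existsP; exists a.
  by apply/existsP; exists a; apply/existsP; exists b; apply/andP.
- move=> x y; split.
    by case/existsP=> a /existsP[b /andP[ab xy]]; exists a, b.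
  case=> a [b [ab xy]].
  by apply/existsP; exists a; apply/existsP; exists b; apply/andP.
Qed.

End CliqueSubdivision.

(** * Branch vertices from the boundary of [Z], connecting subgraphs from the classes *)

Theorem theorem4p1 (T : finType) (e : rel T)
    (e_sym : symmetric e) (e_irr : irreflexive e)
    (CV CE : choiceType) (chiV : T -> CV) (chiE : T -> T -> CE)
    (h t : nat) (X Z : {set T})
    (excl : ~ topological_subgraph (complete_graph h) e)
    (ht : 3 * h ^ 3 <= t)
    (hZ : component_of_deletion e (cl e chiE chiV t X) Z) :
  #|nbhd_set e Z| < h.
Proof.
rewrite ltnNge; apply/negP => leh; apply: excl.
case: hZ => v0 v0D defZ.
have [c [stab clE bigc]] := cl_stable e chiE chiV t X.
set D := cl _ _ _ _ _ in v0D defZ clE.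
have selfc v : v \in color_class c v by rewrite inE.
have v0Z : v0 \in Z by rewrite defZ inE connect0.
have ZD z : z \in Z -> z \notin D.
  rewrite defZ inE => /connectP[p pP ->].
  elim: p v0 v0D pP {defZ v0Z} => //= y p IHp x _.
  by case/andP=> /and3P[_ yD _]; apply: IHp.
have big z : z \in Z -> t < #|color_class c z|.
  by move=> /ZD; rewrite clE; apply: contraNltn => /bigc/eqP.
have Zclosed z w : z \in Z -> w \notin D -> e z w -> w \in Z.
  move=> zZ wD zw; have zD := ZD z zZ; move: zZ; rewrite defZ !inE => v0z.
  by apply: connect_trans v0z _; apply: connect1; rewrite /del_rel /= zD wD.
pose v (i : 'I_h) := enum_val (widen_ord leh i).
have vI : injective v by move=> i j /enum_val_inj[]/val_inj.
have vP i : v i \in D /\ exists2 z, z \in Z & e z (v i).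
  have := enum_valP (widen_ord leh i); rewrite -/(v i) in_setD => /andP[viZ].
  case/bigcupP=> z zZ; rewrite inE => zvi; split; last by exists z.
  by apply: contraR viZ => /(Zclosed z)->.
(* The class of [zof i] is the attachment class of [v i]; by [vP] the default never occurs. *)
pose zof i := odflt (v i) [pick z in Z | e z (v i)].
have zofP i : zof i \in Z /\ e (zof i) (v i).
  have [_ [z zZ zv]] := vP i; rewrite /zof.
  by case: pickP => [x /andP[]|/(_ z)] //=; rewrite zZ zv.
(* The class of [v i] is a singleton, so by equitability every [y] in the class of [zof i] has as
   many neighbors in it as [zof i], namely one. *)
have adjv i y : y \in color_class c (zof i) -> e (v i) y.
  rewrite inE => /eqP Ey; have [viD _] := vP i; have [_ zv] := zofP i.
  have /cards1P[x Ex] : #|color_class c (v i)| == 1 by rewrite -clE.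
  have := stable_equitable (v i) stab Ey.
  have xv : v i = x by apply/set1P; rewrite -Ex.
  rewrite Ex -xv => E1; rewrite e_sym.
  have /card_gt0P[w] : 0 < #|[set x in [set v i] | e y x]|.
    by rewrite E1; apply/card_gt0P; exists (v i); rewrite !inE eqxx.
  by rewrite !inE => /andP[/eqP->].
(* These classes may leave [Z], but having more than one element they avoid [D]. *)
pose Q := [set color_class c z | z in Z].
have trivQ : trivIset Q.
  apply/trivIsetP => _ _ /imsetP[x _ ->] /imsetP[y _ ->] ne.
  rewrite -setI_eq0; apply/eqP/setP => w; rewrite in_setI in_set0; apply/negP.
  by case/andP=> /color_class_eq E1 /color_class_eq E2; rewrite -E1 -E2 eqxx in ne.
pose adj := [rel B C : {set T} | [exists x in B, exists y in C, e x y]].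
have adjP (B C : {set T}) :
    reflect (exists x y, [/\ x \in B, y \in C & e x y]) (adj B C).
  apply: (iffP existsP) => [[x /andP[xB]]|[x [y [xB yC xy]]]].
    case/existsP=> y /andP[yC xy].
    by exists x, y.
  by exists x; rewrite xB; apply/existsP; exists y; rewrite yC.
have adj_sym : symmetric adj.
  move=> B C; apply/adjP/adjP => -[x [y [xB yC xy]]]; exists y, x;
  by rewrite e_sym.
have adjQ : {in Q &, forall B C, adj B C -> spread e B C}.
  move=> _ _ /imsetP[x _ ->] /imsetP[y _ ->] /adjP[b [d [bB dC bd]]].
  apply: biregular_spread bB dC bd => [b' b'B|d' d'C].
    by apply: (stable_equitable _ stab); move: b'B; rewrite inE => /eqP; apply.
  transitivity #|[set b in color_class c x | e y b]|.
    rewrite -(stable_equitable (u := d') x stab).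
      by apply: eq_card => w; rewrite !inE e_sym.
    by move: d'C; rewrite inE => /eqP.
  by [].
have connQ z : z \in Z ->
    connect (restr adj Q) (color_class c v0) (color_class c z).
  rewrite {1}defZ inE => /connectP[p pP ->].
  elim: p v0 v0Z pP {v0D defZ} => //= y p IHp x xZ /andP[/and3P[_ yD xy] pP].
  have yZ := Zclosed x y xZ yD xy; apply: connect_trans (IHp y yZ pP).
  apply: connect1; rewrite /restr /= !imset_f //=.
  by apply/adjP; exists x, y.
(* For [h = 0] there are no attachment classes to link, and the empty subdivision serves. *)
have [h0|h0] := posnP h.
  by apply: (@clique_topological_subgraph _ _ e_sym _ v (fun=> set0)) => //;
    case=> -[i lti]; exfalso; rewrite h0 in lti.
pose A := [set color_class c (zof i) | i : 'I_h].
have Ah : #|A| <= h by rewrite -[leqRHS]card_ord leq_imset_card.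
have AQ : A \subset Q.
  by apply/subsetP => _ /imsetP[i _ ->]; apply: imset_f; case: (zofP i).
have A0 : A != set0.
  apply/set0Pn; exists (color_class c (zof (Ordinal h0))); exact: imset_f.
have m0 : 0 < 3 * h ^ 3 by rewrite muln_gt0 expn_gt0 h0.
have sizeQ : {in Q, forall B : {set T}, 3 * h ^ 3 <= #|B|}.
  by move=> _ /imsetP[z zZ ->]; apply: leq_trans ht _; apply/ltnW/big.
have [|F [F0 _ FB rF lF]] := linkage_exists e_sym trivQ adj_sym adjQ m0 sizeQ
    (subxx Q) (imset_f _ v0Z) AQ A0.
  by move=> _ /imsetP[i _ ->]; apply: connQ; case: (zofP i).
have rp : 0 < #|color_class c v0| by apply/card_gt0P; exists v0.
have aF := locally_matroidal_augmentable FB lF.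
(* As [#|A| <= h], the loss is below [2 * h]; for [q < h * h] the product stays at most [2 * h ^ 3],
   less than the class size bound [3 * h ^ 3]. *)
have [|I IF cI] := augmentable_grow (N := h * h) F0 rp _ aF.
  move=> q qh; have A1 : 0 < #|A| by rewrite card_gt0.
  apply: (@leq_ltn_trans (h.*2 * (h * h))).
    apply: leq_mul (ltnW qh).
    by have le a : 0 < a -> a <= h -> (a.*2 - 2).+1 <= h.*2; [lia | apply: le].
  rewrite !expnS expn0 muln1 [ltnRHS]mulnA ltn_pmul2r ?muln_gt0 ?h0 //.
  by move: h0; clear; lia.
have [H [H1 H2 _ H4]] := rF I IF.
have cI' : #|{: 'I_h * 'I_h}| = #|I| by rewrite card_prod card_ord.
pose g p := enum_val (cast_ord cI' (enum_rank p)).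
have gI p : g p \in I by apply: enum_valP.
have g_inj : injective g by move=> p q /enum_val_inj/cast_ord_inj/enum_rank_inj.
apply: (@clique_topological_subgraph _ _ e_sym _ v (H \o g)) => //=.
- by move=> p; have [] := H1 _ (gI p).
- by move=> p q pq; apply: H4 => //; apply: contra pq => /eqP/g_inj->.
- move=> p i; have [_ _ HQ] := H1 _ (gI p); have [viD _] := vP i.
  apply/negP => /(subsetP HQ)/bigcupP[_ /imsetP[z zZ ->] /color_class_eq E1].
  by have := ZD z zZ; rewrite clE -E1 -clE viD.
- move=> p i; have [y yH yC] := H2 _ (gI p) (color_class c (zof i)) (imset_f _ isT).
  by exists y; rewrite ?adjv.
Qed.
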